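(* Let $\gamma>0$, $p>0$, $p_2\ge p$, $b>0$, $q_{\max}>b+p/\gamma$. For each $p_r\in(0,1]$ let $(\hat b^*(p_r),\hat q^*(p_r))$ be an optimal report, i.e. a maximizer of $$J(\hat b,\hat q)=p_r\max_{q\in[0,q_{\max}]}\big[G(q;b)-\pi_3^{1}(q;\hat b,\hat q)\big]+(1-p_r)\max_{q\in[0,q_{\max}]}\big[G(q;b)-\pi_3^{0}(q;\hat b,\hat q)\big]$$ over $0\le\hat q\le\hat b\le q_{\max}$. Then the optimal reported baseline tends to the true baseline as the probability of call tends to zero: $$\lim_{p_r\to0^+}\hat b^*(p_r)=b.$$
   Context: Notation: $(x)_+=\max(x,0)$. All quantities are real numbers for a single consumer: $b$ is the true baseline, $\gamma$ the marginal-utility parameter, $p$ the energy price, $p_2$ the incentive/penalty price, $q_{\max}$ the maximum allowable consumption, $\hat b$ the reported baseline, $\hat q$ the reported reduced consumption under demand response, $q$ the actual consumption, and $r\in\{0,1\}$ indicates whether the consumer is called ($r=1$) or not ($r=0$), with $\Pr(r=1)=p_r$. The contract requires $\hat b\ge\hat q$. Utility function: $$G(q;b)=\begin{cases}-\frac{\gamma}{2}q^2+(\gamma b+p)q & 0\le q\le b+\frac{p}{\gamma},\\ \frac{p^2}{2\gamma}+\frac{\gamma b^2}{2}+pb & q>b+\frac{p}{\gamma}.\end{cases}$$ Payment scheme of the contract: $$\pi_3^{r}(q;\hat b,\hat q)=\begin{cases}p\max(\hat b,q) & r=0,\\ pq-p_2(\hat b-q)_+ +p_2|q-\hat q| & r=1.\end{cases}$$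 *)

(* Defs.v *)
(* MathComp-Analysis; the real numbers are an arbitrary R : realType. *)
From mathcomp Require Import all_boot all_order all_algebra.
From mathcomp Require Import all_classical all_reals all_analysis.
From mathcomp Require Import ring.

Set Implicit Arguments.
Unset Strict Implicit.
Unset Printing Implicit Defensive.

Import Order.TTheory GRing.Theory Num.Theory.
Import numFieldNormedType.Exports.

Local Open Scope classical_set_scope.
Local Open Scope ring_scope.

Definition pos_part (R : realType) (x : R) : R := Num.max x 0.

(* Only the values at 0 <= q are meaningful. *)
Definition utility (R : realType) (gamma p b q : R) : R :=
  if q <= b + p / gamma then - (gamma / 2) * q ^+ 2 + (gamma * b + p) * q
  else p ^+ 2 / (2 * gamma) + gamma * b ^+ 2 / 2 + p * b.

(* [r] tells whether the consumer is called; [hb] and [hq] are the reported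
   baseline and the reported reduced consumption. *)
Definition payment (R : realType) (p p2 : R) (r : bool) (hb hq q : R) : R :=
  if r then p * q - p2 * pos_part (hb - q) + p2 * `|q - hq|
  else p * Num.max hb q.

(* The greatest element of f(D); the junk value 0 is taken when there is none,
   which [max_over_payoff] rules out for the payoffs below. *)
Definition max_over (R : realType) (D : set R) (f : R -> R) : R :=
  xget 0 (f @` D `&` ubound (f @` D)).

Definition payoff (R : realType) (gamma p p2 b : R) (r : bool) (hb hq q : R)
  : R := utility gamma p b q - payment p p2 r hb hq q.

Definition expected_payoff (R : realType) (gamma p p2 b qmax pr hb hq : R)
  : R :=
  pr * max_over `[0, qmax] (payoff gamma p p2 b true hb hq)
  + (1 - pr) * max_over `[0, qmax] (payoff gamma p p2 b false hb hq).

Definition feasible_report (R : realType) (qmax hb hq : R) : Prop :=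
  [/\ 0 <= hq, hq <= hb & hb <= qmax].

Definition optimal_report (R : realType) (gamma p p2 b qmax pr hb hq : R)
  : Prop :=
  feasible_report qmax hb hq /\
  forall hb' hq' : R, feasible_report qmax hb' hq' ->
    expected_payoff gamma p p2 b qmax pr hb' hq'
    <= expected_payoff gamma p p2 b qmax pr hb hq.

Lemma utility_minE (R : realType) (gamma p b q : R) : 0 < gamma ->
  utility gamma p b q =
  - (gamma / 2) * (Num.min q (b + p / gamma)) ^+ 2
  + (gamma * b + p) * Num.min q (b + p / gamma).
Proof.
move=> g0; rewrite /utility; case: leP => // _.
by field; rewrite gt_eqF.
Qed.

Lemma continuous_payoff (R : realType) (gamma p p2 b : R) (r : bool)
  (hb hq : R) : 0 < gamma -> continuous (payoff gamma p p2 b r hb hq).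
Proof.
move=> g0.
have cC (c : R) : continuous (fun _ : R => c) by move=> x; exact: cvg_cst.
have ci : continuous (fun x : R => x) by move=> x; exact: cvg_id.
have cM (f g : R -> R) : continuous f -> continuous g ->
  continuous (fun x => f x * g x) by move=> cf cg x; exact: cvgM (cf x) (cg x).
have cD (f g : R -> R) : continuous f -> continuous g ->
  continuous (fun x => f x + g x) by move=> cf cg x; exact: cvgD (cf x) (cg x).
have cN (f : R -> R) : continuous f -> continuous (fun x => - f x).
  by move=> cf x; exact: cvgN (cf x).
have ca (f : R -> R) : continuous f -> continuous (fun x => `|f x|).
  by move=> cf x; exact: cvg_norm (cf x).
have cmin (f g : R -> R) : continuous f -> continuous g ->
  continuous (fun x => Num.min (f x) (g x)).
  by move=> cf cg x; exact: continuous_min (cf x) (cg x).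
have cmax (f g : R -> R) : continuous f -> continuous g ->
  continuous (fun x => Num.max (f x) (g x)).
  by move=> cf cg x; exact: continuous_max (cf x) (cg x).
have -> : payoff gamma p p2 b r hb hq = fun q =>
  (- (gamma / 2) * (Num.min q (b + p / gamma) * Num.min q (b + p / gamma))
  + (gamma * b + p) * Num.min q (b + p / gamma)) - payment p p2 r hb hq q.
  by apply/funext => q; rewrite /payoff utility_minE.
have cm : continuous (fun q : R => Num.min q (b + p / gamma)) by exact: (cmin).
apply: (cD); first by apply: (cD); apply: (cM) => //; exact: (cM).
apply: (cN); rewrite /payment /pos_part; case: r; last by apply: (cM) => //; exact: (cmax).
apply: (cD); last by apply: (cM) => //; apply: (ca); apply: (cD).
apply: (cD); first exact: (cM).
by apply: (cN); apply: (cM) => //; apply: (cmax) => //; apply: (cD) => //; exact: (cN).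
Qed.

Lemma max_over_payoff (R : realType) (gamma p p2 b qmax : R) (r : bool)
  (hb hq : R) (f := payoff gamma p p2 b r hb hq) :
  0 < gamma -> 0 <= qmax ->
  (exists2 q, q \in `[0, qmax] & max_over `[0, qmax] f = f q) /\
  (forall q, q \in `[0, qmax] -> f q <= max_over `[0, qmax] f).
Proof.
move=> g0 q0.
have cf : {within `[0, qmax], continuous f}.
  by apply: continuous_subspaceT; exact: continuous_payoff.
have [c cq fc] := EVT_max q0 cf.
have := @xgetI _ 0 (f @` `[0, qmax] `&` ubound (f @` `[0, qmax])) (f c).
rewrite -/(max_over _ f) => -[|[x xq <-] ub].
  by split; [exists c|move=> _ [x xq <-]; exact: fc].
by split; [exists x|move=> q qq; apply: ub; exists q].
Qed.

(* Main.v *)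
Require Import Defs.
From mathcomp Require Import all_boot all_order all_algebra.
From mathcomp Require Import all_classical all_reals all_analysis.
From mathcomp Require Import ring lra.

Import Order.TTheory GRing.Theory Num.Theory.
Import numFieldNormedType.Exports.

Local Open Scope classical_set_scope.
Local Open Scope ring_scope.

(* Let M1 and M0 be the maximal payoffs of a called and of an uncalled consumer.
   Moving the reported baseline from b to hb raises the best attainable M1 by at
   most p2 (hb - b), a negative amount when hb < b. On the other hand M0 is
   maximal at hb = b, and it drops by at least (gamma / 2) min(d, p / gamma) d
   at hb = b + d, d >= 0. Comparing an optimal report with a report of baseline
   b hence gives first hb >= b, then
   (1 - pr) (gamma / 2) min(d, p / gamma) <= pr p2, which forces d to tend to 0
   with pr. *)

(** Completing the square at [b] covers both branches at once: the utility is constant beyond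
    [b + p / gamma], which the truncation [m] encodes. *)
Lemma utility_squareE {R : realType} (gamma p b q : R) : 0 < gamma ->
  let m := Num.min q (b + p / gamma) in
  utility gamma p b q = gamma * b ^+ 2 / 2 + p * m - gamma / 2 * (m - b) ^+ 2.
Proof. by move=> g0 m; rewrite utility_minE// -/m; field. Qed.

Lemma utility_baseline {R : realType} {gamma p : R} (b : R) : 0 < gamma -> 0 <= p ->
  utility gamma p b b = gamma * b ^+ 2 / 2 + p * b.
Proof.
move=> g0 p0; rewrite utility_squareE// min_l ?lerDl ?divr_ge0 ?(ltW g0)//.
by rewrite subrr expr0n mulr0 subr0.
Qed.

(** The bound is the tangent at [b] of the concave utility, whose slope there is [p]. *)
Lemma utility_le {R : realType} {gamma p : R} (b q : R) : 0 < gamma -> 0 <= p ->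
  utility gamma p b q <= gamma * b ^+ 2 / 2 + p * q.
Proof.
move=> g0 p0; rewrite utility_squareE//; set m := Num.min _ _.
have mq : m <= q by rewrite ge_min lexx.
have := mulr_ge0 (ltW g0) (sqr_ge0 (m - b)).
have := ler_wpM2l p0 mq; lra.
Qed.

(** For [q] above [hb] the rebate is zero, but [hq <= hb] makes the penalty for deviating from [hq]
    at least [p2 * (q - hb)]. *)
Lemma called_payoff_le {R : realType} (gamma p : R) {p2 : R} (b : R) {hb hq : R} (q : R) :
  0 <= p2 -> hq <= hb ->
  payoff gamma p p2 b true hb hq q <= utility gamma p b q - p * q + p2 * (hb - q).
Proof.
move=> p20 hqb; rewrite /payoff /payment /pos_part.
have : Num.max (hb - q) 0 - `|q - hq| <= hb - q.
  have := ler_norm (q - hq); have := normr_ge0 (q - hq).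
  by case: (leP (hb - q)) => ? ? ?; lra.
by move/(ler_wpM2l p20); rewrite !mulrBr; lra.
Qed.

Lemma called_payoff_truthful {R : realType} (gamma p p2 b hb q : R) : q <= hb ->
  payoff gamma p p2 b true hb q q = utility gamma p b q - p * q + p2 * (hb - q).
Proof.
move=> qb; rewrite /payoff /payment /pos_part subrr normr0 mulr0 max_l; last lra.
ring.
Qed.

Lemma max_called_le {R : realType} {gamma p p2 b qmax hb hq : R} :
  0 < gamma -> 0 <= p -> 0 <= p2 -> 0 <= b -> b <= qmax -> hq <= hb ->
  exists2 hq', 0 <= hq' <= b &
    max_over `[0, qmax] (payoff gamma p p2 b true hb hq) <=
    max_over `[0, qmax] (payoff gamma p p2 b true b hq') + p2 * (hb - b).
Proof.
move=> g0 p0 p20 b0 bq hqb.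
have q0 : 0 <= qmax by exact: le_trans bq.
have [[q /itvP qq ->] _] := max_over_payoff p p2 b true hb hq g0 q0.
have minb : Num.min q b <= b by rewrite ge_min lexx orbT.
(* Truncating the former best consumption at [b] makes it a feasible report under baseline [b];
   consuming exactly that amount avoids the deviation penalty. *)
exists (Num.min q b); first by rewrite minb le_min qq b0.
have [_ /(_ (Num.min q b))] :=
  max_over_payoff p p2 b true b (Num.min q b) g0 q0.
rewrite in_itv /= le_min qq b0 (le_trans minb bq) => /(_ isT).
rewrite called_payoff_truthful//.
have := called_payoff_le gamma p b q p20 hqb.
case: (leP q b) => [_|bltq]; first by rewrite !mulrBr; lra.
(* Cutting [q] down to [b] loses nothing: utility net of [p * q] is largest at [b], and
   [p2 * (hb - q)] increases. *)
rewrite (utility_baseline b g0 p0); have := utility_le b q g0 p0.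
have := ler_wpM2l p20 (ltW bltq); rewrite !mulrBr; lra.
Qed.

Lemma max_uncalled_ge {R : realType} {gamma p : R} (p2 : R) {b qmax : R} (hq : R) :
  0 < gamma -> 0 <= p -> 0 <= b -> b <= qmax ->
  gamma * b ^+ 2 / 2 <= max_over `[0, qmax] (payoff gamma p p2 b false b hq).
Proof.
move=> g0 p0 b0 bq.
have [_ /(_ b)] := max_over_payoff p p2 b false b hq g0 (le_trans b0 bq).
rewrite in_itv /= b0 bq => /(_ isT).
by rewrite /payoff /payment utility_baseline// maxxx addrK.
Qed.

Lemma max_uncalled_le {R : realType} {gamma p : R} (p2 b : R) {qmax : R} (hb hq : R) :
  0 < gamma -> 0 <= p -> 0 <= qmax ->
  max_over `[0, qmax] (payoff gamma p p2 b false hb hq) <= gamma * b ^+ 2 / 2.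
Proof.
move=> g0 p0 q0.
have [[q _ ->] _] := max_over_payoff p p2 b false hb hq g0 q0.
rewrite /payoff /payment; have := utility_le b q g0 p0.
have : q <= Num.max hb q by rewrite le_max lexx orbT.
by move/(ler_wpM2l p0); lra.
Qed.

(** The consumer pays [p] for each reported unit left unconsumed, or bears a quadratic loss for
    consuming beyond [b]. Marginal utility vanishes at [p / gamma] above [b], hence the cap in the
    minimum. *)
Lemma max_uncalled_overreport {R : realType} {gamma p : R} (p2 : R) {b qmax hb : R} (hq : R) :
  0 < gamma -> 0 <= p -> 0 <= qmax -> b <= hb ->
  max_over `[0, qmax] (payoff gamma p p2 b false hb hq) <=
  gamma * b ^+ 2 / 2 - gamma / 2 * Num.min (hb - b) (p / gamma) * (hb - b).
Proof.
move=> g0 p0 q0 bhb.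
have [[q _ ->] _] := max_over_payoff p p2 b false hb hq g0 q0.
rewrite /payoff /payment utility_squareE//.
set m := Num.min q _; set mu := Num.min (hb - b) _; set M := Num.max hb q.
have mq : m <= q by rewrite ge_min lexx.
have mp : m - b <= p / gamma by rewrite lerBlDl ge_min lexx orbT.
have hM : hb <= M by rewrite le_max lexx.
have qM : q <= M by rewrite le_max lexx orbT.
have mud : mu <= hb - b by rewrite ge_min lexx.
have mup : mu <= p / gamma by rewrite ge_min lexx orbT.
have mu0 : 0 <= mu by rewrite le_min subr_ge0 bhb divr_ge0// ltW.
have gmup : gamma * mu <= p by rewrite mulrC -ler_pdivlMr.
have gmp : gamma * (m - b) <= p by rewrite mulrC -ler_pdivlMr.
(* If [m] exceeds [hb], it overshoots [b] by more than [hb - b], and the quadratic loss alone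
   suffices. *)
case: (leP m hb) => mhb; last first.
  have := ler_wpM2l p0 (le_trans mq qM).
  have : mu * (hb - b) <= (m - b) ^+ 2 by rewrite expr2; apply: ler_pM; lra.
  by move/(ler_wpM2l (ltW g0)); lra.
have mmu : m - b <= mu by rewrite le_min mp andbT; lra.
have := ler_wpM2l p0 hM.
(* e |-> gamma e^2 / 2 - p e is nonincreasing up to p / gamma, so m - b may be
   replaced by mu *)
nra.
Qed.

Lemma optimal_report_bounds {R : realType} {gamma p p2 b qmax pr hb hq : R} :
  0 < gamma -> 0 <= p -> 0 < p2 -> 0 <= b -> b <= qmax -> 0 < pr -> pr <= 1 ->
  optimal_report gamma p p2 b qmax pr hb hq ->
  b <= hb /\
  (1 - pr) * (gamma / 2 * Num.min (hb - b) (p / gamma) * (hb - b))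
    <= pr * p2 * (hb - b).
Proof.
move=> g0 p0 p20 b0 bq pr0 pr1 [[_ hqb _] opt].
have [hq' /andP[hq'0 hq'b] M1] :=
  max_called_le g0 p0 (ltW p20) b0 bq hqb.
have qmax0 := le_trans b0 bq.
have := opt b hq' (And3 hq'0 hq'b bq); rewrite /expected_payoff.
have {M1} := ler_wpM2l (ltW pr0) M1; rewrite mulrDr mulrA.
move: (max_over _ (payoff _ _ _ _ true hb hq)) => M1.
move: (max_over _ (payoff _ _ _ _ true b hq')) => M1'.
have npr : 0 <= 1 - pr by lra.
have := ler_wpM2l npr (max_uncalled_ge p2 hq' g0 p0 b0 bq).
move=> lo up le.
(* The uncalled terms can only favour baseline [b], so optimality leaves
   [0 <= pr * p2 * (hb - b)]. *)
have bhb : b <= hb.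
  rewrite -subr_ge0 -(pmulr_rge0 _ (mulr_gt0 pr0 p20)).
  by have := ler_wpM2l npr (max_uncalled_le p2 b hb hq g0 p0 qmax0); lra.
split=> //.
have := ler_wpM2l npr (max_uncalled_overreport p2 hq g0 p0 qmax0 bhb).
rewrite mulrBr; lra.
Qed.

Theorem corollary5 (R : realType) (gamma p p2 b qmax : R)
    (hgamma : 0 < gamma) (hp : 0 < p) (hp2 : p <= p2) (hb0 : 0 < b)
    (hqmax : b + p / gamma < qmax)
    (hb hq : R -> R)
    (hopt : forall pr : R, 0 < pr -> pr <= 1 ->
      optimal_report gamma p p2 b qmax pr (hb pr) (hq pr)) :
  hb pr @[pr --> 0^'+] --> b.
Proof.
have p20 : 0 < p2 by exact: lt_le_trans hp2.
have pg0 : 0 < p / gamma by rewrite divr_gt0.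
have bq : b <= qmax by lra.
apply/cvgrPdist_lt => e e0.
(* Capping [e] at [p / gamma] makes [eta] a lower bound of the minimum in [optimal_report_bounds]
   once [hb pr - b] reaches [e]. *)
set eta := Num.min e (p / gamma).
have eta0 : 0 < eta by rewrite lt_min e0 pg0.
have ge0 : 0 < gamma * eta by rewrite mulr_gt0.
have D0 : 0 < 2 * p2 + gamma * eta by lra.
(* This threshold is the [pr] at which [(1 - pr) * gamma * eta / 2] equals [pr * p2]. *)
have c0 : 0 < gamma * eta / (2 * p2 + gamma * eta) by rewrite divr_gt0.
near=> pr.
have pr0 : 0 < pr by near: pr; exact: nbhs_right_gt.
have : pr < gamma * eta / (2 * p2 + gamma * eta) by near: pr; exact: nbhs_right_lt.
rewrite ltr_pdivlMr// => small.
have pr1 : pr <= 1 by near: pr; exact: nbhs_right_le.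
have [bhb] := optimal_report_bounds hgamma (ltW hp) p20 (ltW hb0) bq pr0 pr1
  (hopt pr pr0 pr1).
rewrite distrC ger0_norm ?subr_ge0//; set d := hb pr - b => le.
rewrite ltNge; apply/negP => ed.
have d0 : 0 < d by exact: lt_le_trans ed.
have eta_le : eta <= Num.min d (p / gamma).
  by rewrite le_min !ge_min ed lexx orbT.
move: le; rewrite mulrA ler_pM2r// => le.
have npr : 0 <= (1 - pr) * (gamma / 2) by rewrite mulr_ge0; lra.
have := ler_wpM2l npr eta_le; lra.
Unshelve. all: by end_near.
Qed.
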